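(* Let $\mathcal{A} \subseteq M_n$ be a hereditarily antisymmetric operator algebra. Then there is a normalized suitably nonorthogonal block ordered basis $(v^1_1, \ldots, v^1_{n_1}, \ldots, v^k_1, \ldots, v^k_{n_k})$ of $\mathbb{C}^n$ with respect to which the matrix of every element of $\mathcal{A}$ is $(n_1,\ldots,n_k)$-Jordanesque.
   Context: $M_n = M_n(\mathbb{C})$ is identified with the linear operators on the Hilbert space $\mathbb{C}^n$, with the standard inner product and adjoint. An operator algebra in $M_n$ is a complex linear subspace closed under products (not necessarily unital, not necessarily self-adjoint). An operator algebra $\mathcal{B}$ of operators on a Hilbert space is antisymmetric if $\mathcal{B} \cap \mathcal{B}^*$ is $\{0\}$ or $\mathbb{C}\cdot I$. A subspace $\mathcal{E}$ is invariant for $\mathcal{A}$ if $A(\mathcal{E}) \subseteq \mathcal{E}$ for all $A \in \mathcal{A}$; it is semi-invariant for $\mathcal{A}$ if $\mathcal{E} = \mathcal{E}_1 \ominus \mathcal{E}_2 = \mathcal{E}_1\cap\mathcal{E}_2^\perp$ for some invariant subspaces $\mathcal{E}_2 \subseteq \mathcal{E}_1$. If $P$ is the orthogonal projection onto a semi-invariant subspace $\mathcal{E}$, then $P\mathcal{A}P$, regarded as a subset of $B(\mathcal{E})$, is an operator algebra, called a subquotient of $\mathcal{A}$. $\mathcal{A}$ is hereditarily antisymmetric if every subquotient of $\mathcal{A}$ is antisymmetric (as an operator algebra in $B(\mathcal{E})$). A block ordered basis of $\mathbb{C}^n$ is an ordered (not necessarily orthogonal) basis together with integers $n_1,\ldots,n_k>0$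 with $n_1+\cdots+n_k=n$; the basis is listed by blocks as $(v^1_1,\ldots,v^1_{n_1},\ldots,v^k_1,\ldots,v^k_{n_k})$. It is normalized if for each $j$ the set $\{v^j_1,\ldots,v^j_{n_j}\}$ is orthonormal. For $0\le m_j\le n_j$ ($1 \leq j \leq k$), the $(m_1,\ldots,m_k)$ subspace is ${\rm span}\{v^j_i: 1\le j\le k,\ 1\le i\le m_j\}$. The basis is suitably nonorthogonal if for all $0\le m_1\le n_1,\ldots,0\le m_k\le n_k$ and all $1\le j<j'\le k$ with $m_j<n_j$ and $m_{j'}<n_{j'}$ we have $\langle Pv^j_{m_j+1}, v^{j'}_{m_{j'}+1}\rangle\ne 0$, where $P$ is the orthogonal projection onto the orthocomplement of the $(m_1,\ldots,m_k)$ subspace. A matrix is $(n_1,\ldots,n_k)$-Jordanesque if it is block diagonal with diagonal blocks of sizes $n_1,\ldots,n_k$ (in this order), each block being upper triangular and constant on its main diagonal (the constant may depend on the block). *)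

(* Defs.v *)
From HB Require Import structures.
From mathcomp Require Import all_boot all_order all_algebra.
From mathcomp Require Import boolp classical_sets reals complex.

Set Implicit Arguments.
Unset Strict Implicit.
Unset Printing Implicit Defensive.

Import Order.TTheory GRing.Theory Num.Theory.
Local Open Scope classical_set_scope.
Local Open Scope ring_scope.
Local Open Scope sesquilinear_scope.

Section InnerProduct.
Variable C : numClosedFieldType.

(* [form_of_matrix] with the identity matrix is [\tr (u *m v ^t conjC)], i.e.
   [\sum_i u i 0 * (v i 0)^*] for column vectors (see [dotcvE]).  The library's
   [dotmx] is the same form on row vectors. *)
Definition dotcv n (u v : 'cV[C]_n) : C :=
  form_of_matrix Num.conj 1%:M u v.

HB.instance Definition _ n :=
  Bilinear.copy (@dotcv n) (form_of_matrix Num.conj 1%:M).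
HB.instance Definition _ n :=
  Hermitian.copy (@dotcv n) (form_of_matrix Num.conj 1%:M).

Lemma dotcvE n (u v : 'cV[C]_n) : dotcv u v = \sum_i u i 0 * (v i 0)^*.
Proof.
rewrite /dotcv /form_of_matrix mulmx1 /mxtrace.
by apply: eq_bigr => i _; rewrite !mxE big_ord1 !mxE.
Qed.

Fact dotcv_is_dot n (u : 'cV[C]_n) : u != 0 -> 0 < dotcv u u.
Proof.
move=> u0; have [i ui0] : exists i, u i 0 != 0.
  apply/existsP; apply: contraNT u0 => /existsPn u0.
  by apply/eqP/colP => i; rewrite mxE; apply/eqP; rewrite -[_ == _]negbK u0.
rewrite dotcvE (bigD1 i) //= ltr_pwDl -?normCK ?exprn_gt0 ?normr_gt0 //.
by apply: sumr_ge0 => j _; rewrite -normCK exprn_ge0.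
Qed.

HB.instance Definition _ n :=
  isDotProduct.Build _ _ (@dotcv n) (@dotcv_is_dot n).

Definition orthocomp n (E : {vspace 'cV[C]_n}) : {vspace 'cV[C]_n} :=
  orthov (@dotcv n) E.

(* The projection onto [E] along its orthocomplement. *)
Definition orthoproj n (E : {vspace 'cV[C]_n}) : 'End('cV[C]_n) :=
  daddv_pi E (orthocomp E).

End InnerProduct.

Section OperatorAlgebras.
Variables (C : numClosedFieldType) (n : nat).
Implicit Types (A : {vspace 'M[C]_n}) (E : {vspace 'cV[C]_n}).

Definition operator_algebra A : Prop := {in A &, forall a b, a *m b \in A}.

(* B(E) is ['End(subvs_of E)], the inner product of E being inherited from
   C^n. *)
Definition is_adjoint E (T S : 'End(subvs_of E)) : Prop :=
  forall x y, dotcv (vsval (T x)) (vsval y) = dotcv (vsval x) (vsval (S y)).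

Definition adjoint_set E (B : set 'End(subvs_of E)) : set 'End(subvs_of E) :=
  [set S | exists2 T, B T & is_adjoint T S].

Definition antisymmetric_algebra E (B : set 'End(subvs_of E)) : Prop :=
  B `&` adjoint_set B = [set 0] \/
  B `&` adjoint_set B = [set c *: \1%VF | c in [set: C]].

Definition invariant A E : Prop :=
  forall a x, a \in A -> x \in E -> a *m x \in E.

Definition semi_invariant A E : Prop :=
  exists E1 E2 : {vspace 'cV[C]_n},
    [/\ invariant A E1, invariant A E2, (E2 <= E1)%VS
      & E = (E1 :&: orthocomp E2)%VS].

(* The operators P a P, for a in A, as operators on E. *)
Definition subquotient A E : set 'End(subvs_of E) :=
  [set T | exists2 a, a \in A &
     forall x, vsval (T x) = orthoproj E (a *m orthoproj E (vsval x))].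

Definition hereditarily_antisymmetric A : Prop :=
  forall E, semi_invariant A E -> antisymmetric_algebra (@subquotient A E).

End OperatorAlgebras.

Section BlockOrderedBases.
Variables (C : numClosedFieldType) (n k : nat) (p : 'I_k -> nat).
Implicit Type v : (\sum_j p j).-tuple 'cV[C]_n.

(* Blocks and vectors within a block are numbered from 0, so that
   [block_vec v j i] is v^{j+1}_{i+1}; [tagnat.Rank j i] is the position
   [p 0 + ... + p (j - 1) + i] in the list. *)
Definition block_vec v (j : 'I_k) (i : 'I_(p j)) : 'cV[C]_n :=
  tnth v (tagnat.Rank j i).

Definition block_ordered_basis v : Prop :=
  [/\ forall j, (0 < p j)%N, (\sum_j p j)%N = n & basis_of fullv v].

Definition normalized v : Prop :=
  forall j, orthonormal (@dotcv C n) [seq block_vec v i | i : 'I_(p j)].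

Definition multi_subspace v (m : 'I_k -> nat) : {vspace 'cV[C]_n} :=
  (\sum_j \sum_(i < p j | (i < m j)%N) <[block_vec v i]>)%VS.

(* Numbering from 1, [block_vec v (Ordinal hj)] is
   v^j_{m_j + 1}. *)
Definition suitably_nonorthogonal v : Prop :=
  forall m : 'I_k -> nat, (forall j, (m j <= p j)%N) ->
  forall (j j' : 'I_k) (hj : (m j < p j)%N) (hj' : (m j' < p j')%N),
    (j < j')%N ->
    dotcv (orthoproj (orthocomp (multi_subspace v m))
                     (block_vec v (Ordinal hj)))
          (block_vec v (Ordinal hj')) != 0.

(* When [v] is a basis, column [j] lists the coordinates of [a *m v_j]. *)
Definition matrix_in_basis v (a : 'M[C]_n) : 'M[C]_(\sum_j p j) :=
  \matrix_(i, j) coord v i (a *m tnth v j).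

Definition jordanesque (M : 'M[C]_(\sum_j p j)) : Prop :=
  (forall j j', j != j' -> submxblock M j j' = 0) /\
  (forall j, (forall a b : 'I_(p j), (b < a)%N -> submxblock M j j a b = 0) /\
             exists c, forall a : 'I_(p j), submxblock M j j a a = c).

End BlockOrderedBases.

(* Main.v *)
(* Everything happens modulo an invariant subspace E.  A compression of an
   element of A to a semi-invariant subspace that is the orthogonal projection
   onto a line is self-adjoint, hence scalar, so the semi-invariant subspace is
   that line.  By Burnside's argument, irreducible subquotients would otherwise
   contain such projections; so they have dimension one and carry weights
   (characters of A).  Two distinct weights in a two-dimensional subquotient
   admit joint eigenvectors, which are not orthogonal: otherwise the subquotient
   would contain the projection onto one of them.  Hence distinct weights split
   off, and vectors added one at a time, each orthonormalized against the
   previous ones of its own weight, form a basis that is triangular within each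
   weight; the blocks are the weights. *)
Require Import Defs.
From mathcomp Require Import all_boot all_order all_algebra.
From mathcomp Require Import boolp classical_sets reals complex.
From mathcomp Require Import ring.
Local Open Scope ring_scope.

Set Implicit Arguments.
Unset Strict Implicit.
Unset Printing Implicit Defensive.

Import Order.TTheory GRing.Theory Num.Theory.

(* [invariant] would otherwise denote the unrelated predicate of eqtype. *)
Local Notation invariant := Defs.invariant.

(** * Orthogonal complements and projections *)

Section Orthogonality.
Variables (C : numClosedFieldType) (n : nat).
Implicit Types (u v w : 'cV[C]_n) (E F : {vspace 'cV[C]_n}).

Lemma dotcvC u v : dotcv u v = (dotcv v u)^*.
Proof. by rewrite [LHS](hermC (@dotcv C n)) expr0 mul1r. Qed.

Lemma dotcvDl u v w : dotcv (u + v) w = dotcv u w + dotcv v w.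
Proof. exact: linearDl. Qed.

Lemma dotcvBl u v w : dotcv (u - v) w = dotcv u w - dotcv v w.
Proof. exact: linearBl. Qed.

Lemma dotcvZl c u v : dotcv (c *: u) v = c * dotcv u v.
Proof. exact: linearZl_LR. Qed.

Lemma dotcvZr c u v : dotcv u (c *: v) = c^* * dotcv u v.
Proof. exact: linearZr_LR. Qed.

Lemma dotcv_eq0 u : (dotcv u u == 0) = (u == 0).
Proof. exact: dnorm_eq0. Qed.

Lemma orthocompP E u :
  reflect {in E, forall v, dotcv u v = 0} (u \in orthocomp E).
Proof. exact: mem_orthovP. Qed.

Lemma cap_orthocomp E : (E :&: orthocomp E = 0)%VS.
Proof.
apply/eqP; rewrite -subv0; apply/subvP => u.
rewrite memv_cap => /andP[Eu /orthocompP/(_ _ Eu)/eqP].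
by rewrite dotcv_eq0 memv0.
Qed.

Lemma orthocomp_split E u : exists2 v, v \in E & u - v \in orthocomp E.
Proof.
have [v Ev [w [-> _ orth_w]]] := orthogonal_split (@dotcv C n) (vbasis E) u.
exists v; first by rewrite (span_basis (vbasisP E)) in Ev.
rewrite addrAC subrr add0r; apply/orthocompP => z Ez.
apply: (span_orthogonal orth_w); first by rewrite span_seq1 memv_line.
by rewrite (span_basis (vbasisP E)).
Qed.

Lemma orthoproj_id E u : u \in E -> orthoproj E u = u.
Proof. exact: daddv_pi_id (cap_orthocomp E). Qed.

Lemma orthoproj_sub E u : u - orthoproj E u \in orthocomp E.
Proof.
have [v Ev uv] := orthocomp_split E u.
have Eu : u \in (E + orthocomp E)%VS by rewrite -[u](subrKC v) memv_add.
rewrite -{1}[u](daddv_pi_add (cap_orthocomp E) Eu) addrAC subrr add0r.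
exact: memv_pi.
Qed.

Lemma orthoproj_unique E u v : v \in E -> u - v \in orthocomp E ->
  orthoproj E u = v.
Proof.
move=> Ev uv; apply/eqP; rewrite -subr_eq0 -memv0 -(cap_orthocomp E).
rewrite memv_cap rpredB ?memv_pi //=.
have -> : orthoproj E u - v = (u - v) - (u - orthoproj E u).
  by rewrite opprB [RHS]addrC addrA subrK.
by rewrite rpredB ?orthoproj_sub.
Qed.

(** The component of [u] orthogonal to [E] is orthogonal to [u] and to [E], hence to itself. *)
Lemma orthocompK E : orthocomp (orthocomp E) = E.
Proof.
apply/eqP; rewrite eqEsubv; apply/andP; split; last first.
  apply/subvP => u Eu; apply/orthocompP => v /orthocompP/(_ _ Eu) uv.
  by rewrite dotcvC uv rmorph0.
apply/subvP => u uE; have [v Ev uv] := orthocomp_split E u.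
have /eqP : dotcv (u - v) (u - v) = 0.
  rewrite dotcvBl (orthocompP _ _ uE) // dotcvC (orthocompP _ _ uv) //.
  by rewrite rmorph0 subr0.
by rewrite dotcv_eq0 subr_eq0 => /eqP ->.
Qed.

Lemma orthoproj_orthocomp_sub E u : u - orthoproj (orthocomp E) u \in E.
Proof. by rewrite -{2}(orthocompK E) orthoproj_sub. Qed.

Lemma orthoproj_orthocomp_eq0 E u :
  (orthoproj (orthocomp E) u == 0) = (u \in E).
Proof.
apply/eqP/idP => [u0|Eu].
  by have := orthoproj_orthocomp_sub E u; rewrite u0 subr0.
by apply: orthoproj_unique; rewrite ?mem0v // subr0 orthocompK.
Qed.

End Orthogonality.

(** * Compressions to semi-invariant subspaces and the effect of antisymmetry *)

Section Compressions.
Variables (C : numClosedFieldType) (n : nat).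
Implicit Types (A : {vspace 'M[C]_n}) (E : {vspace 'cV[C]_n}).

(** The innermost projection of $PaP$ is dropped, since it fixes every vector of [E]. *)
Definition compression E (a : 'M[C]_n) : 'End(subvs_of E) :=
  linfun (vsproj E \o orthoproj E \o mulmx a \o vsval).

Lemma compressionE E a x :
  vsval (compression E a x) = orthoproj E (a *m vsval x).
Proof. by rewrite lfunE /= vsprojK ?memv_pi. Qed.

Lemma compression_subquotient A E a : a \in A ->
  @subquotient C n A E (compression E a).
Proof.
move=> Aa; exists a => // x.
by rewrite compressionE (orthoproj_id (subvsP x)).
Qed.

(** A self-adjoint element of a subquotient $B$ lies in $B \cap B^*$, and both sets allowed by
    antisymmetry consist of scalars. *)
Lemma selfadjoint_compression_scalar A E a :
    hereditarily_antisymmetric A -> semi_invariant A E -> a \in A ->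
    is_adjoint (compression E a) (compression E a) ->
  exists c, forall u, u \in E -> orthoproj E (a *m u) = c *: u.
Proof.
move=> hA sE Aa adj; set T := compression E a in adj.
pose B := @subquotient C n A E.
have BT : (B `&` adjoint_set B)%classic T.
  by split; last exists T => //; apply: compression_subquotient.
have [c Tc] : exists c, T = c *: \1%VF.
  case: (hA E sE) => eqB; move: BT; rewrite /B eqB; last first.
    by case=> c _ <-; exists c.
  by move=> ->; exists 0; rewrite scale0r.
exists c => u Eu; have := compressionE a (vsproj E u).
rewrite -/T Tc vsprojK // => <-.
by rewrite scale_lfunE id_lfunE linearZ /= vsprojK.
Qed.

(* The compression of b to E1 - E2 is the orthogonal projection onto the line
   spanned by w, hence self-adjoint, hence scalar. *)
Lemma line_projection_dim1 A E1 E2 b w :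
    hereditarily_antisymmetric A -> invariant A E1 -> invariant A E2 ->
    (E2 <= E1)%VS -> b \in A ->
    w \in (E1 :&: orthocomp E2)%VS -> w != 0 -> b *m w - w \in E2 ->
    {in (E1 :&: orthocomp E2)%VS,
      forall u, dotcv u w = 0 -> b *m u \in E2} ->
  (E1 <= E2 + <[w]>)%VS.
Proof.
move=> hA iE1 iE2 E21 Ab; set E := (E1 :&: _)%VS => Ew w0 bw bu.
(* [E2] is orthogonal to [E], so compressions to [E] may be computed modulo [E2]. *)
have E2E u : u \in E2 -> u \in orthocomp E.
  move=> E2u; apply/orthocompP => v.
  rewrite memv_cap => /andP[_ /orthocompP vE2].
  by rewrite dotcvC vE2 // rmorph0.
have ww0 : dotcv w w != 0 by rewrite dotcv_eq0.
have TE u : u \in E -> orthoproj E (b *m u) = (dotcv u w / dotcv w w) *: w.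
  set c := _ / _ => Eu; apply: orthoproj_unique; first exact: memvZ.
  apply: E2E.
  have -> : b *m u - c *: w = b *m (u - c *: w) + c *: (b *m w - w).
    by rewrite mulmxBr scalerBr -scalemxAr addrA subrK.
  rewrite rpredD ?memvZ // bu ?rpredB ?memvZ //.
  by rewrite dotcvBl dotcvZl divfK // subrr.
have [|x y|c Tc] := @selfadjoint_compression_scalar A E b hA _ Ab.
- by exists E1, E2; split.
- rewrite !compressionE !TE ?subvsP // dotcvZl dotcvZr rmorphM fmorphV.
  transitivity (dotcv w (vsval y) / dotcv w w * dotcv (vsval x) w).
    by rewrite mulrAC [RHS]mulrAC [X in X / _]mulrC.
  by congr (_ / _ * _); apply: dotcvC.
have c0 : c != 0.
  apply: contraNneq w0 => c0; have := Tc w Ew; rewrite TE // divff // c0.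
  by rewrite scale1r scale0r => ->.
(* The compression is the nonzero scalar [c], yet its values lie on the line of [w]; so [E] is
   contained in that line. *)
have Ew' u : u \in E -> u \in <[w]>%VS.
  move=> Eu; apply/vlineP; exists (c^-1 * (dotcv u w / dotcv w w)).
  by rewrite -scalerA -TE // Tc // scalerA mulVf // scale1r.
apply/subvP => z E1z; have [v E2v zv] := orthocomp_split E2 z.
rewrite -[z](subrKC v) memv_add // Ew' // memv_cap zv andbT rpredB //.
exact: (subvP E21).
Qed.

(* If alpha <> beta and alpha <> 0, then (a^2 - beta a) / (alpha^2 - alpha beta)
   compresses to the orthogonal projection onto the line x. *)
Lemma orthogonal_eigenvectors_eq A E1 E2 a x y alpha beta :
    operator_algebra A -> hereditarily_antisymmetric A ->
    invariant A E1 -> invariant A E2 ->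
    (E1 = E2 + <[x]> + <[y]>)%VS -> a \in A ->
    x \in orthocomp E2 -> y \in orthocomp E2 -> x != 0 -> y != 0 ->
    dotcv x y = 0 -> a *m x - alpha *: x \in E2 -> a *m y - beta *: y \in E2 ->
  alpha = beta.
Proof.
move=> opA hA iE1 iE2 eE1 Aa xE2 yE2 x0 y0 xy ax ay.
apply/eqP/negPn/negP => ab.
(* The situation is symmetric in the two eigenvectors, and distinct eigenvalues cannot both
   vanish. *)
wlog alpha0 : x y alpha beta eE1 xE2 yE2 x0 y0 xy ax ay ab / alpha != 0.
  move=> W; have [alpha0|alpha0] := eqVneq alpha 0; last first.
    exact: (W x y alpha beta).
  have beta0 : beta != 0 by rewrite -alpha0 eq_sym.
  apply: (W y x beta alpha) => //; last by rewrite eq_sym.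
    by rewrite eE1 -!addvA [(<[x]> + _)%VS]addvC.
  by rewrite dotcvC xy rmorph0.
have E2E1 : (E2 <= E1)%VS by rewrite eE1 -addvA addvSl.
have E1x : x \in E1.
  rewrite eE1; apply: (subvP (addvSl _ _)).
  by rewrite (subvP (addvSr _ _)) ?memv_line.
have E1y : y \in E1 by rewrite eE1 (subvP (addvSr _ _)) ?memv_line.
(* Since [x] and [y] are orthogonal to [E2], the remaining component of [u] in [E2] is orthogonal to
   [E2] too, hence zero. *)
have Es u : u \in (E1 :&: orthocomp E2)%VS -> exists c d, u = c *: x + d *: y.
  rewrite memv_cap eE1 => /andP[/memv_addP[z]].
  move=> /memv_addP[e Ee [_ /vlineP[c ->] ->]] [_ /vlineP[d ->] ->] orth.
  exists c, d.
  suff -> : e = 0 by rewrite add0r.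
  apply/eqP; rewrite -memv0 -(cap_orthocomp E2) memv_cap Ee /=.
  have -> : e = (e + c *: x + d *: y) - (c *: x + d *: y).
    by rewrite -[X in X - _]addrA addrK.
  by rewrite rpredB // rpredD // memvZ.
pose k := alpha * (alpha - beta).
have k0 : k != 0 by rewrite mulf_neq0 // subr_eq0.
pose b := k^-1 *: (a *m a - beta *: a).
have Ab : b \in A by rewrite memvZ // rpredB ?memvZ ?opA.
have bE u c : a *m u - c *: u \in E2 ->
    b *m u - (k^-1 * (c * (c - beta))) *: u \in E2.
  move=> au.
  have -> : b *m u - (k^-1 * (c * (c - beta))) *: u =
     k^-1 *: (a *m (a *m u - c *: u) + (c - beta) *: (a *m u - c *: u)).
    rewrite /b -scalemxAl -scalerA -scalerBr mulmxBl -scalemxAl mulmxBr mulmxA.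
    rewrite -scalemxAr; congr (_ *: _); set s := _ *m u; set t := a *m u.
    by apply/matrixP => i j; rewrite !mxE; ring.
  by rewrite memvZ // rpredD ?memvZ // iE2.
have bx : b *m x - x \in E2.
  by have := bE x alpha ax; rewrite mulVf // scale1r.
have byE : b *m y \in E2.
  by have := bE y beta ay; rewrite subrr !mulr0 scale0r subr0.
have : (E1 <= E2 + <[x]>)%VS.
  apply: (line_projection_dim1 hA iE1 iE2 E2E1 Ab _ x0 bx).
    by rewrite memv_cap E1x.
  move=> u /Es[c [d ->]]; rewrite dotcvDl !dotcvZl [dotcv y x]dotcvC xy rmorph0.
  rewrite mulr0 addr0 => /eqP; rewrite mulf_eq0 dotcv_eq0 (negPf x0) orbF.
  by move=> /eqP->; rewrite scale0r add0r -scalemxAr memvZ.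
(* Now [y] lies in [E2 + <[x]>] and is orthogonal to both summands, which forces [y = 0]. *)
move=> /subvP/(_ y E1y)/memv_addP[e Ee [_ /vlineP[c ->] eqy]].
have /eqP : dotcv y y = 0.
  rewrite {1}eqy dotcvDl dotcvZl xy mulr0 addr0 dotcvC.
  by rewrite (orthocompP _ _ yE2) ?rmorph0.
by rewrite dotcv_eq0 (negPf y0).
Qed.

End Compressions.

(** * Invariant lines modulo an invariant subspace *)

Section ChiefSteps.
Variables (C : numClosedFieldType) (n : nat).
Implicit Types (A : {vspace 'M[C]_n}) (E F G : {vspace 'cV[C]_n}).

(** By Cayley-Hamilton the product of the factors [T - r] over the roots of the characteristic
    polynomial kills [z]. Applying the factors one at a time, the last vector still outside [E] is
    an eigenvector modulo [E]. *)
Lemma eigenvector_mod E G (T : 'M[C]_n) z :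
    {in E, forall u, T *m u \in E} -> {in G, forall u, T *m u \in G} ->
    z \in G -> z \notin E ->
  exists lambda z', [/\ z' \in G, z' \notin E & T *m z' - lambda *: z' \in E].
Proof.
case: n E G T z => [|m] E G T z ET GT Gz Ez.
  by rewrite [z]flatmx0 mem0v in Ez.
have [rs def_rs] := closed_field_poly_normal (char_poly T).
have : horner_mx T (\prod_(r <- rs) ('X - r%:P)) *m z \in E.
  have := Cayley_Hamilton T; rewrite def_rs.
  by rewrite (monicP (char_poly_monic T)) scale1r => ->; rewrite mul0mx mem0v.
elim: rs z Gz Ez {def_rs} => [|r rs IH] z Gz Ez.
  by rewrite big_nil rmorph1 mul1mx (negPf Ez).
rewrite big_cons mulrC rmorphM /= rmorphB /= horner_mx_X horner_mx_C.
rewrite -mulmxE -mulmxA mulmxBl mul_scalar_mx => Pz.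
have [Ez'|Ez'] := boolP (T *m z - r *: z \in E); first by exists r, z.
by apply: IH Ez' Pz; rewrite rpredB ?memvZ ?GT.
Qed.

Lemma invariant0 A : invariant A 0%VS.
Proof. by move=> a u _; rewrite !memv0 => /eqP->; rewrite mulmx0. Qed.

Lemma invariantD A E F :
  invariant A E -> invariant A F -> invariant A (E + F)%VS.
Proof.
move=> iE iF a u Aa /memv_addP[v Ev [w Fw ->]].
by rewrite mulmxDr memv_add ?iE ?iF.
Qed.

(* Burnside: an element of least nonzero rank modulo E2 has rank one, and an
   irreducible algebra containing a rank one operator contains an orthogonal
   projection onto a line. *)
Lemma minimal_invariant_line A E1 E2 :
    operator_algebra A -> hereditarily_antisymmetric A ->
    invariant A E1 -> invariant A E2 -> (E2 <= E1)%VS -> ~~ (E1 <= E2)%VS ->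
    (forall F, invariant A F -> (E2 <= F)%VS -> (F <= E1)%VS ->
       (F <= E2)%VS \/ (E1 <= F)%VS) ->
  exists x, [/\ x \in E1, x \notin E2 & invariant A (E2 + <[x]>)%VS].
Proof.
move=> opA hA iE1 iE2 E21 E12 min1; apply: contrapT => noline.
(* Transitivity modulo [E2]: by minimality the invariant space $Ax + E2$ is [E1], unless it is [E2],
   and then [x] would span an invariant line modulo [E2]. *)
have trans x y : x \in E1 -> x \notin E2 -> y \in E1 ->
    exists2 c, c \in A & c *m x - y \in E2.
  move=> E1x E2x E1y; pose F := (linfun (mulmxr x) @: A + E2)%VS.
  have Fax a : a \in A -> a *m x \in F.
    move=> Aa; apply: (subvP (addvSl _ _)).
    by apply/memv_imgP; exists a; rewrite ?lfunE.
  have iF : invariant A F.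
    move=> a u Aa /memv_addP[_ /memv_imgP[c Ac ->] [e Ee ->]].
    rewrite mulmxDr lfunE /= mulmxA rpredD ?Fax ?opA //.
    by rewrite (subvP (addvSr _ _)) ?iE2.
  case: (min1 F iF (addvSr _ _)) => [|FE2|/subvP/(_ y E1y)].
  - rewrite subv_add E21 andbT; apply/subvP => _ /memv_imgP[c Ac ->].
    by rewrite lfunE iE1.
  - case: noline; exists x; split=> // a u Aa.
    move=> /memv_addP[e Ee [_ /vlineP[c ->] ->]]; rewrite mulmxDr.
    apply: (subvP (addvSl _ _)); rewrite rpredD //; first exact: iE2.
    by rewrite -scalemxAr memvZ // (subvP FE2) ?Fax.
  move=> /memv_addP[_ /memv_imgP[c Ac ->] [e Ee ->]]; exists c => //.
  by rewrite lfunE /= opprD addNKr rpredN.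
(* Adding [E2] makes the dimension of [im a] the rank of [a] modulo [E2], up to the constant
   [\dim E2]. *)
pose im a := (linfun (mulmx a) @: E1 + E2)%VS.
pose nz a := exists2 u, u \in E1 & a *m u \notin E2.
have imP a u : u \in E1 -> a *m u \in im a.
  move=> E1u; apply: (subvP (addvSl _ _)).
  by apply/memv_imgP; exists u; rewrite ?lfunE.
have [a [Aa [x E1x ax] min_a]] : exists a, [/\ a \in A, nz a &
    forall a', a' \in A -> nz a' -> (\dim (im a) <= \dim (im a'))%N].
  pose P d := `[< exists a, [/\ a \in A, nz a & \dim (im a) = d] >].
  have exP : exists d, P d.
    have /subvPn[x E1x E2x] := E12.
    have [c Ac cx] := trans x x E1x E2x E1x.
    exists (\dim (im c)); apply/asboolP; exists c; split=> //; exists x => //.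
    apply: contraNN E2x => cxE2.
    by rewrite -[x](subKr (c *m x)) rpredB.
  case: (ex_minnP exP) => d /asboolP[a [Aa nza <-]] min_d.
  exists a; split=> // a' Aa' nza'; apply: min_d; apply/asboolP.
  by exists a'.
(* [K] is the kernel of [a] modulo [E2]. Replacing [x] by its component [w] orthogonal to [K] does
   not change its image modulo [E2]. *)
pose K := (E1 :&: (linfun (mulmx a) @^-1: E2))%VS.
have memK u : (u \in K) = (u \in E1) && (a *m u \in E2).
  by rewrite memv_cap -memv_preim lfunE.
have [v Kv wK] := orthocomp_split K x; set w := x - v in wK.
have [E1v av] := andP (etrans (esym (memK v)) Kv).
have E1w : w \in E1 by rewrite rpredB.
have aw : a *m w \notin E2.
  apply: contraNN ax => awE; rewrite -[x](subrK v) mulmxDr rpredD //.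
clearbody w.
(* Otherwise take [c] with $caw = u$ and an eigenvalue [l] of $ac$ on [im a], both modulo [E2]. Then
   $a' = (ac - l)a$ is nonzero modulo [E2], because $a'w = au - l\,aw$ there, and its rank is
   smaller than that of [a]. *)
have rank1 u : u \in E1 -> exists t, a *m u - t *: (a *m w) \in E2.
  move=> E1u; apply: contrapT => nt.
  have [c Ac cw] := trans (a *m w) u (iE1 _ _ Aa E1w) aw E1u.
  have [||||l [z [Gz E2z Sz]]] := @eigenvector_mod E2 (im a) (a *m c) (a *m w).
  - by move=> y Ey; rewrite iE2 ?opA.
  - move=> y /memv_addP[_ /memv_imgP[y1 E1y ->] [e Ee ->]].
    rewrite mulmxDr -!mulmxA lfunE /= rpredD ?imP ?iE1 //.
    by rewrite (subvP E21).
  - exact: imP.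
  - exact: aw.
  pose f := a *m c - l%:M; pose a' := f *m a.
  have Aa' : a' \in A.
    by rewrite /a' mulmxBl mul_scalar_mx rpredB ?memvZ // !opA.
  have nza' : nz a'.
    exists w => //; apply/negP => a'w; apply: nt; exists l.
    have -> : a *m u - l *: (a *m w) = a' *m w - a *m (c *m (a *m w) - u).
      rewrite /a' /f -[X in _ = X - _]mulmxA mulmxBl mul_scalar_mx.
      rewrite mulmxBr opprB.
      by rewrite -mulmxA [RHS]addrC addrA subrK.
    by rewrite rpredB // iE2.
  have := min_a _ Aa' nza'; rewrite leqNgt => /negP; apply.
  (* [f] maps [E2 + <[z]>] into [E2], so modulo [E2] the image of [a'] comes from the complement [H]
     alone, and the dimension drops. *)
  pose H := (im a :\: (E2 + <[z]>))%VS.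
  have le_im : (im a' <= E2 + linfun (mulmx f) @: H)%VS.
    rewrite subv_add addvSl andbT; apply/subvP => _ /memv_imgP[y E1y ->].
    have := imP a y E1y; rewrite -(addv_diff_cap (im a) (E2 + <[z]>)%VS).
    move=> /memv_addP[h Hh [s]]; rewrite memv_cap => /andP[_].
    move=> /memv_addP[e Ee [_ /vlineP[t ->] ->]] eq_ay.
    rewrite lfunE /= -mulmxA eq_ay !mulmxDr addrC memv_add //; last first.
      by apply/memv_imgP; exists h; rewrite ?lfunE.
    rewrite rpredD //; last first.
      by rewrite -scalemxAr memvZ // mulmxBl mul_scalar_mx.
    by rewrite mulmxBl mul_scalar_mx rpredB ?memvZ // iE2 ?opA.
  apply: (leq_ltn_trans (dimvS le_im)).
  apply: (leq_ltn_trans (leq_of_leqif (dimv_add_leqif _ _))).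
  rewrite -(dimv_cap_compl (im a) (E2 + <[z]>)%VS) -addSn.
  rewrite leq_add //; last first.
    by rewrite -(limg_ker_dim (linfun (mulmx f)) H) leq_addl.
  have -> : (im a :&: (E2 + <[z]>) = E2 + <[z]>)%VS.
    by apply/capv_idPr; rewrite subv_add addvSr -memvE.
  rewrite ltn_neqAle dimvS ?addvSl // andbT; apply: contraNneq E2z => eqd.
  have /eqP-> : E2 == (E2 + <[z]>)%VS by rewrite eqEdim addvSl eqd leqnn.
  by rewrite (subvP (addvSr _ _)) ?memv_line.
(* Modulo [E2], the product $ba$ fixes [w] and, by [rank1], kills the vectors of [E1] orthogonal to
   [E2] and [w]: it compresses to the projection onto the line of [w]. *)
have [b Ab bw] := trans (a *m w) w (iE1 _ _ Aa E1w) aw E1w.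
have E2K : (E2 <= K)%VS.
  by apply/subvP => y Ey; rewrite memK (subvP E21) // iE2.
have w0 : w != 0 by apply: contraNneq aw => ->; rewrite mulmx0 mem0v.
have wE : w \in (E1 :&: orthocomp E2)%VS.
  rewrite memv_cap E1w /=; apply/orthocompP => y Ey.
  by rewrite (orthocompP _ _ wK) // (subvP E2K).
have E1s : (E1 <= E2 + <[w]>)%VS.
  apply: (line_projection_dim1 hA iE1 iE2 E21 (opA _ _ Ab Aa) wE w0).
    by rewrite -mulmxA.
  move=> u; rewrite memv_cap => /andP[E1u uE2] uw.
  have [t at_] := rank1 u E1u.
  have Kut : u - t *: w \in K.
    by rewrite memK rpredB ?memvZ // mulmxBr -scalemxAr.
  have /eqP : dotcv (u - t *: w) w = 0.
    by rewrite dotcvC (orthocompP _ _ wK) // rmorph0.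
  rewrite dotcvBl dotcvZl uw sub0r oppr_eq0 mulf_eq0 dotcv_eq0 (negPf w0) orbF.
  move=> /eqP t0; rewrite t0 scale0r subr0 in at_.
  by rewrite -mulmxA iE2.
case: noline; exists w; split=> //.
  by apply: contraNN aw; apply: iE2.
suff -> : (E2 + <[w]>)%VS = E1 by [].
by apply/eqP; rewrite eqEsubv E1s subv_add E21 -memvE E1w.
Qed.

(** Induction on the dimension of [E1]: an invariant subspace strictly between [E2] and [E1] can
    replace [E1]; if there is none, the minimal case applies. *)
Lemma invariant_line A E1 E2 :
    operator_algebra A -> hereditarily_antisymmetric A ->
    invariant A E1 -> invariant A E2 -> (E2 <= E1)%VS -> ~~ (E1 <= E2)%VS ->
  exists x, [/\ x \in E1, x \notin E2 & invariant A (E2 + <[x]>)%VS].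
Proof.
move=> opA hA + iE2; have [d] := ubnP (\dim E1).
elim: d E1 => // d IH E1 led iE1 E21 E12.
case: (pselect (exists F, [/\ invariant A F, (E2 <= F)%VS, (F <= E1)%VS,
    ~~ (F <= E2)%VS & ~~ (E1 <= F)%VS])) => [[F [iF E2F FE1 FE2 E1F]]|noF].
  have [|x [Fx E2x ix]] := IH F _ iF E2F FE2.
    move: led; rewrite ltnS; apply: leq_trans.
    rewrite ltn_neqAle dimvS // andbT; apply: contraNneq E1F => eqd.
    by rewrite -(eqP (_ : F == E1)) // eqEdim FE1 eqd /=.
  by exists x; rewrite (subvP FE1).
apply: minimal_invariant_line => // F iF E2F FE1.
case: (boolP (F <= E2)%VS) => [|FE2]; first by left.
case: (boolP (E1 <= F)%VS) => [|E1F]; first by right.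
by case: noF; exists F.
Qed.

End ChiefSteps.

(** Proves linear identities between vectors: products are expanded and made opaque, and [ring]
    settles the entries. *)
Ltac mx_module :=
  rewrite ?mulmxDr ?mulmxDl ?mulmxBr ?mulmxBl ?mulmxN ?mulNmx
    -?scalemxAr -?scalemxAl -?mulmxA;
  repeat match goal with |- context [@mulmx ?R ?m ?p ?q ?a ?b] =>
    let t := fresh "t" in set t := (@mulmx R m p q a b); clearbody t end;
  intros; apply/matrixP => ? ?; rewrite !mxE; ring.

(** * Weights modulo an invariant subspace, and the splitting of distinct weights *)

Section Weights.
Variables (C : numClosedFieldType) (n : nat) (A : {vspace 'M[C]_n}).
Implicit Types (E F U : {vspace 'cV[C]_n}) (x y : 'cV[C]_n).
Implicit Types (lambda mu : 'M[C]_n -> C).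

(* Weights vanish outside A, so that they are equal as soon as they agree
   on A. *)
Definition weight_mod E x lambda : Prop := forall a,
  if a \in A then is_true (a *m x - lambda a *: x \in E) else lambda a = 0.

Lemma weight_mod_in E x lambda a : weight_mod E x lambda -> a \in A ->
  a *m x - lambda a *: x \in E.
Proof. by move=> /(_ a); case: ifP. Qed.

Lemma exists_weight_mod E x : invariant A (E + <[x]>)%VS ->
  exists lambda, weight_mod E x lambda.
Proof.
move=> iEx.
suff: forall a : 'M[C]_n, exists c,
    if a \in A then is_true (a *m x - c *: x \in E) else c = 0.
  by move=> /boolp.choice[lambda]; exists lambda.
move=> a; have [Aa|_] := boolP (a \in A); last by exists 0.
have /memv_addP[e Ee [_ /vlineP[c ->] ax]] : a *m x \in (E + <[x]>)%VS.
  by rewrite iEx // (subvP (addvSr _ _)) ?memv_line.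
by exists c; rewrite ax addrK.
Qed.

Lemma weight_mod_neq E F x y lambda mu :
    weight_mod E x lambda -> weight_mod F y mu -> lambda <> mu ->
  exists2 a, a \in A & lambda a != mu a.
Proof.
move=> wx wy neq; apply: contrapT => eqA; apply: neq; apply/funext => a.
have := wx a; have := wy a; case: ifP => [Aa _ _|_ -> -> //].
by apply/eqP/negPn/negP => neq; apply: eqA; exists a.
Qed.

Lemma invariant_weight E x lambda :
  invariant A E -> weight_mod E x lambda -> invariant A (E + <[x]>)%VS.
Proof.
move=> iE wx a u Aa /memv_addP[e Ee [_ /vlineP[c ->] ->]].
rewrite mulmxDr rpredD //; first by rewrite (subvP (addvSl _ _)) ?iE.
rewrite -scalemxAr memvZ //.
rewrite -[a *m x](subrK (lambda a *: x)) memv_add ?memvZ ?memv_line //.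
exact: weight_mod_in.
Qed.

Lemma weight_modS E F x lambda : (E <= F)%VS ->
  weight_mod E x lambda -> weight_mod F x lambda.
Proof. by move=> /subvP EF wx a; have := wx a; case: ifP => // _ /EF. Qed.

Lemma weight_modD E x z lambda : invariant A E -> z \in E ->
  weight_mod E x lambda -> weight_mod E (x + z) lambda.
Proof.
move=> iE Ez wx a; have := wx a; case: ifP => // Aa ax.
rewrite mulmxDr scalerDr opprD addrACA rpredD // rpredB ?memvZ //.
exact: iE.
Qed.

Lemma weight_modZ E x c lambda :
  weight_mod E x lambda -> weight_mod E (c *: x) lambda.
Proof.
move=> wx a; have := wx a; case: ifP => // Aa ax.
by rewrite -scalemxAr scalerA mulrC -scalerA -scalerBr memvZ.
Qed.

Lemma addv_line_congr E x z : x - z \in E -> (E + <[x]> = E + <[z]>)%VS.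
Proof.
suff sub u v : u - v \in E -> (E + <[u]> <= E + <[v]>)%VS.
  move=> Exz; apply/eqP; rewrite eqEsubv !sub //.
  by rewrite -opprB rpredN.
move=> Euv; rewrite subv_add addvSl -memvE.
by rewrite -[u](subrK v) memv_add ?memv_line.
Qed.

Hypotheses (opA : operator_algebra A) (hA : hereditarily_antisymmetric A).

(* If the lines x and y did not split modulo E, a commutator would act as a
   nilpotent operator y |-> x; subtracting a multiple of it diagonalizes some
   element of A in the orthogonal basis (x, y). *)
Lemma split_weight_ortho E x y lambda mu :
    invariant A E -> x \in orthocomp E -> x != 0 ->
    y \in orthocomp (E + <[x]>)%VS -> y != 0 ->
    weight_mod E x lambda -> weight_mod (E + <[x]>)%VS y mu -> lambda <> mu ->
  exists c, weight_mod E (y + c *: x) mu.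
Proof.
move=> iE xE x0 yEx y0 wx wy neq.
have [a0 Aa0 neq0] := weight_mod_neq wx wy neq.
set l0 := lambda a0 in neq0; set m0 := mu a0 in neq0.
have yE : y \in orthocomp E.
  apply/orthocompP => z Ez; apply: (orthocompP _ _ yEx).
  exact: (subvP (addvSl _ _)).
have xy : dotcv x y = 0.
  rewrite dotcvC (orthocompP _ _ yEx) ?rmorph0 //.
  by rewrite (subvP (addvSr _ _)) ?memv_line.
have ax0 : a0 *m x - l0 *: x \in E := weight_mod_in wx Aa0.
have [nu ay0] : exists nu, a0 *m y - m0 *: y - nu *: x \in E.
  have /memv_addP[e Ee [_ /vlineP[nu ->] ay]] := weight_mod_in wy Aa0.
  by exists nu; rewrite ay addrK.
(* Subtracting [nu / k] times [d] cancels the off-diagonal coefficient [nu] of [a0], leaving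
   orthogonal eigenvectors with the distinct eigenvalues [l0] and [m0]. *)
have no_nilpotent d k : d \in A ->
    d *m x \in E -> d *m y - k *: x \in E -> k = 0.
  move=> Ad dx dy; apply/eqP/negPn/negP => k0; case/eqP: neq0.
  pose a := a0 - (nu / k) *: d.
  have Aa : a \in A by rewrite rpredB ?memvZ.
  pose E1 := (E + <[x]> + <[y]>)%VS.
  apply: (@orthogonal_eigenvectors_eq _ _ A E1 E a x y) => //.
  - by apply: invariant_weight wy; apply: invariant_weight wx.
  - have -> : a *m x - l0 *: x = (a0 *m x - l0 *: x) - (nu / k) *: (d *m x).
      by rewrite /a; mx_module.
    by rewrite rpredB ?memvZ.
  have -> : a *m y - m0 *: y =
      (a0 *m y - m0 *: y - nu *: x) - (nu / k) *: (d *m y - k *: x).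
    rewrite -[in nu *: x](divfK k0 nu) /a.
    by move: (nu / k) => ?; mx_module.
  by rewrite rpredB ?memvZ.
have neq0' : m0 - l0 != 0 by rewrite subr_eq0 eq_sym.
(* [c] solves [nu + c * l0 = c * m0], which makes [y1] an eigenvector of [a0] modulo [E]. *)
pose c := nu / (m0 - l0); pose y1 := y + c *: x.
have ay1 : a0 *m y1 - m0 *: y1 \in E.
  have -> : a0 *m y1 - m0 *: y1 =
      (a0 *m y - m0 *: y - nu *: x) + c *: (a0 *m x - l0 *: x).
    rewrite -[in nu *: x](divfK neq0' nu) -/c /y1.
    by move: c {y1} => ?; mx_module.
  by rewrite rpredD ?memvZ.
have wy1 : weight_mod (E + <[x]>)%VS y1 mu.
  apply: weight_modD => //; first exact: invariant_weight wx.
  by rewrite memvZ // (subvP (addvSr _ _)) ?memv_line.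
exists c => b; have := wy1 b; case: ifP => // Ab; rewrite -/y1.
case/memv_addP => e Ee [_ /vlineP[r ->] by1].
(* [r] is the obstruction to [y1] being an eigenvector of [b]. Modulo [E], the commutator of [a0]
   and [b] kills [x] and sends [y1] to [r * (l0 - m0)] times [x], so [no_nilpotent] applies. *)
suff r0 : r = 0 by rewrite by1 r0 scale0r addr0.
have by1E : b *m y1 - mu b *: y1 - r *: x \in E by rewrite by1 addrK.
have bx : b *m x - lambda b *: x \in E := weight_mod_in wx Ab.
pose d := a0 *m b - b *m a0.
have dx : d *m x \in E.
  have -> : d *m x = a0 *m (b *m x - lambda b *: x)
      + lambda b *: (a0 *m x - l0 *: x)
      - (b *m (a0 *m x - l0 *: x) + l0 *: (b *m x - lambda b *: x)).
    by rewrite /d; mx_module.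
  by rewrite rpredB // rpredD ?memvZ // iE.
have dy1 : d *m y1 - (r * (l0 - m0)) *: x \in E.
  have -> : d *m y1 - (r * (l0 - m0)) *: x =
      a0 *m (b *m y1 - mu b *: y1 - r *: x) + mu b *: (a0 *m y1 - m0 *: y1)
      + r *: (a0 *m x - l0 *: x) - (b *m (a0 *m y1 - m0 *: y1)
      + m0 *: (b *m y1 - mu b *: y1 - r *: x)).
    by rewrite /d; clearbody y1; mx_module.
  by rewrite rpredB // !rpredD ?memvZ // iE.
have : r * (l0 - m0) = 0.
  apply: (no_nilpotent d) => //; first by rewrite rpredB ?opA.
  have -> : d *m y - (r * (l0 - m0)) *: x =
      (d *m y1 - (r * (l0 - m0)) *: x) - c *: (d *m x).
    by rewrite /y1; clearbody d; mx_module.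
  by rewrite rpredB ?memvZ.
by move=> /eqP; rewrite mulf_eq0 subr_eq0 (negPf neq0) orbF => /eqP.
Qed.

(** Reduction to the orthogonal case: [x] may be changed by a vector of [E] and [y] by a vector of
    [E + <[x]>], which only alters [c]. *)
Lemma split_weight E x y lambda mu :
    invariant A E -> weight_mod E x lambda -> weight_mod (E + <[x]>)%VS y mu ->
    lambda <> mu -> y \notin (E + <[x]>)%VS ->
  exists c, weight_mod E (y + c *: x) mu.
Proof.
move=> iE wx wy neq yEx; have [Ex|xE] := boolP (x \in E).
  exists 0; rewrite scale0r addr0; apply: weight_modS wy.
  by rewrite subv_add subvv -memvE.
have [e Ee xe] := orthocomp_split E x; set x' := x - e in xe.
have eq_x : (E + <[x]> = E + <[x']>)%VS.
  by apply: addv_line_congr; rewrite subKr.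
have wx' : weight_mod E x' lambda by apply: weight_modD; rewrite ?rpredN.
have [v + yv] := orthocomp_split (E + <[x']>)%VS y.
case/memv_addP => [e' Ee' [_ /vlineP[t ->] def_v]].
have Ev : v \in (E + <[x']>)%VS by rewrite def_v memv_add ?memvZ ?memv_line.
have [|||c] :=
  @split_weight_ortho E x' (y - v) lambda mu iE xe _ yv _ wx' _ neq.
- by apply: contraNneq xE => /eqP; rewrite subr_eq0 => /eqP ->.
- by apply: contraNneq yEx => /eqP; rewrite subr_eq0 eq_x => /eqP ->.
- apply: weight_modD; rewrite ?rpredN //; last by rewrite -eq_x.
  exact: invariant_weight wx'.
(* This correction in [E] turns [y - v + c *: x'] into [y + (c - t) *: x]. *)
move=> /(weight_modD iE (_ : e' + (c - t) *: e \in E)) wc; exists (c - t).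
have -> : y + (c - t) *: x = y - v + c *: x' + (e' + (c - t) *: e).
  by rewrite def_v /x'; mx_module.
by apply: wc; rewrite rpredD ?memvZ.
Qed.

End Weights.

(** * Building the basis one weight vector at a time *)

Section AdaptedSequences.
Variables (C : numClosedFieldType) (n : nat) (A : {vspace 'M[C]_n}).
Implicit Types (E U : {vspace 'cV[C]_n}) (x y : 'cV[C]_n).
Implicit Types (lambda mu : 'M[C]_n -> C).
Implicit Types (l : seq ('cV[C]_n * ('M[C]_n -> C))).

Definition weight_vectors mu l := [seq z.1 | z <- l & z.2 == mu].

(* The latest vector comes first. *)
Fixpoint adapted l : Prop :=
  if l is z :: l' then
    [/\ adapted l', weight_mod A <<weight_vectors z.2 l'>> z.1 z.2,
        z.1 \notin <<unzip1 l'>>%VS, dotcv z.1 z.1 = 1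
      & z.1 \in orthocomp <<weight_vectors z.2 l'>>]
  else True.

Lemma weight_vectors_sub mu l : (<<weight_vectors mu l>> <= <<unzip1 l>>)%VS.
Proof.
apply: sub_span => _ /mapP[z + ->].
by rewrite mem_filter => /andP[_ /(map_f fst)].
Qed.

Lemma weight_vectors_cons mu z l : weight_vectors mu (z :: l) =
  if z.2 == mu then z.1 :: weight_vectors mu l else weight_vectors mu l.
Proof. by rewrite /weight_vectors /=; case: ifP. Qed.

Lemma invariant_weight_vectors mu l : adapted l ->
  invariant A <<weight_vectors mu l>>.
Proof.
elim: l => [_|z l IH [/IH il wz _ _ _]].
  by rewrite span_nil; apply: invariant0.
rewrite weight_vectors_cons; case: eqP => // eq_mu; rewrite span_cons addvC.
by rewrite eq_mu in wz; apply: invariant_weight wz.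
Qed.

Lemma adapted_invariant l : adapted l -> invariant A <<unzip1 l>>.
Proof.
elim: l => [_|z l IH [/IH il wz _ _ _]].
  by rewrite span_nil; apply: invariant0.
rewrite span_cons addvC; apply: invariant_weight il _.
exact: weight_modS (weight_vectors_sub _ _) wz.
Qed.

Lemma adapted_dim l : adapted l -> \dim <<unzip1 l>> = size l.
Proof.
elim: l => [_|z l IH [/IH dim_l _ zl _ _]]; first by rewrite span_nil dimv0.
rewrite -/unzip1 /= span_cons addvC -dim_l.
apply/eqP; rewrite eqn_leq; apply/andP; split.
  apply: leq_trans (leq_of_leqif (dimv_add_leqif _ _)) _.
  by rewrite dim_vline addnC; case: eqP.
rewrite ltn_neqAle dimvS ?addvSl // andbT; apply: contraNneq zl => eqd.
have /eqP-> : <<unzip1 l>>%VS == (<<unzip1 l>> + <[z.1]>)%VS.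
  by rewrite eqEdim addvSl eqd leqnn.
by rewrite (subvP (addvSr _ _)) ?memv_line.
Qed.

Hypotheses (opA : operator_algebra A) (hA : hereditarily_antisymmetric A).

(** Vectors of weight other than [mu] are removed from the modulus one by one with [split_weight];
    those of weight [mu] are moved into the accumulator [U]. *)
Lemma weight_mod_descent l U y mu :
    adapted l -> invariant A (U + <<weight_vectors mu l>>)%VS ->
    y \notin (U + <<unzip1 l>>)%VS -> weight_mod A (U + <<unzip1 l>>)%VS y mu ->
  exists2 y', y' - y \in (U + <<unzip1 l>>)%VS
            & weight_mod A (U + <<weight_vectors mu l>>)%VS y' mu.
Proof.
elim: l U y => [|[x lambda] l IH] U y.
  by move=> _ _ _ wy; exists y; rewrite ?subrr ?mem0v.
case=> al wx _ _ _ /=; rewrite weight_vectors_cons /= span_cons.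
case: eqP => [eq_mu|neq].
  by rewrite span_cons !addvA => iU yU wy; apply: IH.
move=> iU; rewrite [(<[x]> + _)%VS]addvC addvA => yU wy.
pose E := (U + <<unzip1 l>>)%VS.
(* [U] alone is not assumed invariant; [E] is a sum of two spaces that are. *)
have iE : invariant A E.
  have -> : E = (U + <<weight_vectors mu l>> + <<unzip1 l>>)%VS.
    by rewrite -addvA (addv_idPr (weight_vectors_sub _ _)).
  by apply: invariantD iU _; apply: adapted_invariant.
have {}wx : weight_mod A E x lambda.
  apply: weight_modS wx; apply: subv_trans (addvSr _ _).
  exact: weight_vectors_sub.
have [c wy1] := split_weight opA hA iE wx wy neq yU.
have cx : c *: x \in (E + <[x]>)%VS.
  by rewrite memvZ // (subvP (addvSr _ _)) ?memv_line.
have [|y' y'E wy'] := IH U _ al iU _ wy1; last first.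
  exists y' => //; have -> : y' - y = y' - (y + c *: x) + c *: x.
    by rewrite opprD addrA subrK.
  by rewrite rpredD // (subvP (addvSl _ _)).
apply: contraNN yU => y1E; rewrite -[y](addrK (c *: x)) rpredB //.
exact: (subvP (addvSl _ _)).
Qed.

(** An invariant line modulo the span of [l] yields a weight [mu]. Descent makes its vector a weight
    vector modulo the vectors of weight [mu] only; it is then orthogonalized against these and
    normalized, which preserves the weight. *)
Lemma adapted_extend l : adapted l -> <<unzip1 l>>%VS != fullv ->
  exists z, adapted (z :: l).
Proof.
move=> al lT; have il := adapted_invariant al.
have [|||x [_ xl /exists_weight_mod[mu wx]]] :=
  @invariant_line C n A fullv <<unzip1 l>>%VS opA hA _ il.
- by move=> ? ? _ _; apply: memvf.
- exact: subvf.
- by apply: contraNN lT => ?; rewrite eqEsubv subvf.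
have [|||y yx wy] := @weight_mod_descent l 0%VS x mu al; rewrite ?add0v //.
  exact: invariant_weight_vectors.
rewrite !add0v in yx wy; have iV := @invariant_weight_vectors mu l al.
have [v Vv yv] := orthocomp_split <<weight_vectors mu l>>%VS y.
have lv : v \in <<unzip1 l>>%VS := subvP (weight_vectors_sub _ _) _ Vv.
have yvl : y - v \notin <<unzip1 l>>%VS.
  apply: contraNN xl => yvl.
  have -> : x = (y - v) + v - (y - x) by rewrite subrK subKr.
  by rewrite rpredB // rpredD.
have yv0 : dotcv (y - v) (y - v) != 0.
  by rewrite dotcv_eq0; apply: contraNneq yvl => ->; apply: mem0v.
pose s := sqrtC (dotcv (y - v) (y - v)).
have s0 : s != 0 by rewrite sqrtC_eq0.
exists (s^-1 *: (y - v), mu); split=> //=.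
- by apply/weight_modZ/weight_modD; rewrite ?rpredN.
- by apply: contraNN yvl => /(memvZ s); rewrite scalerA divff // scale1r.
- rewrite dotcvZl dotcvZr mulrA -normCK normfV.
  rewrite ger0_norm ?sqrtC_ge0 ?dnorm_ge0 //.
  by rewrite exprVn sqrtCK mulVf.
- exact: memvZ.
Qed.

Lemma exists_adapted_basis : exists2 l, adapted l & <<unzip1 l>>%VS = fullv.
Proof.
suff ext d l : (n - size l < d)%N -> adapted l ->
    exists2 l, adapted l & <<unzip1 l>>%VS = fullv.
  exact: (ext n.+1 [::] (leq_subr _ _)).
elim: d l => // d IH l led al.
have [|lT] := eqVneq <<unzip1 l>>%VS fullv; first by exists l.
have [z az] := adapted_extend al lT; apply: (IH (z :: l)) az.
have szl : (size l < n)%N.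
  have dimT : \dim {:'cV[C]_n} = n by rewrite dimvf /dim /= muln1.
  rewrite -(adapted_dim al) -[X in (_ < X)%N]dimT.
  rewrite ltn_neqAle dimvS ?subvf // andbT; apply: contraNneq lT => eqd.
  by rewrite eqEdim subvf eqd leqnn.
by move: led; rewrite /= ltnS; apply: leq_trans; rewrite ltn_sub2l.
Qed.

End AdaptedSequences.

(** * The block basis, with one block for each weight *)

Section BlockBasis.
Variables (C : numClosedFieldType) (n : nat) (A : {vspace 'M[C]_n}).
Variable l : seq ('cV[C]_n * ('M[C]_n -> C)).
Hypotheses (al : adapted A l) (lT : <<unzip1 l>>%VS = fullv).

Definition weights := undup (unzip2 l).
Definition weight (j : 'I_(size weights)) := nth (fun=> 0) weights j.
(** Adapted lists start with the latest vector; reversal restores the order of construction, in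
    which the action is upper triangular. *)
Definition weight_block (j : 'I_(size weights)) :=
  rev (weight_vectors (weight j) l).
Definition block_size (j : 'I_(size weights)) := size (weight_block j).
Definition block_basis : (\sum_j block_size j).-tuple 'cV[C]_n :=
  [tuple (weight_block (tagnat.sig1 s))`_(tagnat.sig2 s)
  | s < \sum_j block_size j].

Local Notation v := block_basis.

Lemma block_vecE j (i : 'I_(block_size j)) :
  block_vec v i = (weight_block j)`_i.
Proof.
by rewrite /block_vec tnth_mktuple tagnat.Rank2K /= tagnat.Rank1K.
Qed.

Lemma block_size_gt0 j : (0 < block_size j)%N.
Proof.
have : weight j \in unzip2 l by rewrite -mem_undup mem_nth.
case/mapP => z lz eq_w.
rewrite /block_size size_rev size_map size_filter -has_count.
by apply/hasP; exists z; rewrite //= eq_w eqxx.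
Qed.

(** The block sizes are the multiplicities of the distinct weights in [unzip2 l]. *)
Lemma sum_block_size : (\sum_j block_size j)%N = size l.
Proof.
rewrite -(size_map snd l) -(perm_size (perm_count_undup (unzip2 l))).
rewrite size_flatten /shape -map_comp sumnE big_map -/weights.
rewrite (big_nth (fun=> 0)) big_mkord; apply: eq_bigr => j _.
rewrite /block_size size_rev size_map size_filter /= size_nseq count_map.
exact: eq_count.
Qed.

Lemma mem_block_vec j (i : 'I_(block_size j)) : block_vec v i \in tval v.
Proof. by rewrite /block_vec mem_tnth. Qed.

Lemma block_basis_spans : <<v>>%VS = fullv.
Proof.
apply/eqP; rewrite eqEsubv subvf -lT; apply/span_subvP => _ /mapP[z lz ->].
apply: memv_span.
have wz : z.2 \in weights by rewrite mem_undup map_f.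
pose j := Ordinal (etrans (index_mem _ _) wz).
have wj : weight j = z.2 by rewrite /weight nth_index.
have Bz : z.1 \in weight_block j.
  by rewrite mem_rev wj; apply: map_f; rewrite mem_filter eqxx.
rewrite -(nth_index 0 Bz).
by rewrite -(block_vecE (Ordinal (etrans (index_mem _ _) Bz))) mem_block_vec.
Qed.

Lemma block_basis_ordered : block_ordered_basis v.
Proof.
have dimT : \dim {:'cV[C]_n} = n by rewrite dimvf /dim /= muln1.
have eq_n : (\sum_j block_size j)%N = n.
  by rewrite sum_block_size -(adapted_dim al) lT dimT.
split; [exact: block_size_gt0 | exact: eq_n | rewrite basisEdim].
by rewrite block_basis_spans subvv size_tuple dimT eq_n leqnn.
Qed.

Lemma orthonormal_weight_vectors mu l' : adapted A l' ->
  orthonormal (@dotcv C n) (weight_vectors mu l').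
Proof.
elim: l' => [//|z l' IH [/IH on_l' _ _ zz zl']].
rewrite weight_vectors_cons; case: eqP => // eq_mu; rewrite -eq_mu in on_l' *.
rewrite -cat1s orthonormal_cat on_l' andTb; apply/andP; split.
  by rewrite /orthonormal /= zz eqxx.
rewrite orthogonalE; apply/orthovP => x y /=.
rewrite span_seq1 => /vlineP[c ->] ly.
by rewrite linearZl_LR /= (orthocompP _ _ zl') ?mulr0.
Qed.

Lemma block_basis_normalized : normalized v.
Proof.
move=> j.
suff -> : [seq block_vec v i | i : 'I_(block_size j)] = weight_block j.
  have /eq_orthonormal-> :
      perm_eq (weight_block j) (weight_vectors (weight j) l).
    by rewrite /weight_block perm_rev.
  exact: orthonormal_weight_vectors.
rewrite /image_mem (eq_map (@block_vecE j)).
rewrite (map_comp (nth 0 (weight_block j)) val) val_enum_ord.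
exact: mkseq_nth.
Qed.

(** After reversal a new vector is appended at the end, so it follows exactly the vectors modulo
    which it has weight [mu], and earlier prefixes stay the same. *)
Lemma weight_vectors_triangular mu l' i : adapted A l' ->
  (i < size (weight_vectors mu l'))%N ->
  weight_mod A <<take i (rev (weight_vectors mu l'))>>
    (rev (weight_vectors mu l'))`_i mu.
Proof.
elim: l' => [//|z l' IH [/IH{}IH wz _ _ _]].
rewrite weight_vectors_cons; case: eqP => // eq_mu.
rewrite rev_cons /= ltnS nth_rcons -cats1 size_rev.
rewrite leq_eqVlt => /orP[/eqP->|lti].
  rewrite ltnn eqxx take_size_cat ?size_rev // -eq_mu.
  by apply: weight_modS wz; apply: sub_span => x; rewrite mem_rev.
by rewrite lti takel_cat ?size_rev 1?ltnW //; apply: IH.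
Qed.

Lemma weight_block_triangular j i : (i < block_size j)%N ->
  weight_mod A <<take i (weight_block j)>> (weight_block j)`_i (weight j).
Proof. by rewrite /block_size size_rev; apply: weight_vectors_triangular. Qed.

Lemma invariant_take_block j m : invariant A <<take m (weight_block j)>>.
Proof.
elim: m => [|m IH]; first by rewrite take0 span_nil; apply: invariant0.
have [ltm|lem] := ltnP m (block_size j); last first.
  by rewrite take_oversize 1?leqW // -(take_oversize lem).
rewrite (take_nth 0 ltm) -cats1 span_cat span_seq1.
exact: invariant_weight (weight_block_triangular ltm).
Qed.

Lemma coord_block_vec t j (i : 'I_(block_size j)) :
  coord v t (block_vec v i) = (t == tagnat.Rank j i)%:R.
Proof.
have [_ _ /basis_free free_v] := block_basis_ordered.
by rewrite /block_vec (tnth_nth 0) (coord_free _ _ free_v) eq_sym.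
Qed.

Lemma coord_eq0_span t (X : seq 'cV[C]_n) u :
  {in X, forall x, coord v t x = 0} -> u \in <<X>>%VS -> coord v t u = 0.
Proof.
move=> X0; suff : (<<X>> <= lker (linfun (coord v t : 'cV[C]_n -> C^o)))%VS.
  by move=> /subvP/(_ u)/[apply]; rewrite memv_ker lfunE => /eqP.
by apply/span_subvP => x /X0; rewrite memv_ker lfunE /= => ->.
Qed.

Lemma multi_subspaceE m : (forall j, (m j <= block_size j)%N) ->
  multi_subspace v m = (\sum_j <<take (m j) (weight_block j)>>)%VS.
Proof.
move=> lem; apply: eq_bigr => j _.
rewrite span_def (big_nth 0) size_takel ?lem // big_mkord.
pose F i := <[(take (m j) (weight_block j))`_i]>%VS.
rewrite (big_ord_widen _ F (lem j)) /F.
by apply: eq_bigr => i lti; rewrite nth_take // block_vecE.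
Qed.

(** Counting from 0, position [m j] is the first one of block [j] left out of the spanning
    vectors. *)
Lemma coord_multi_subspace m j (hj : (m j < block_size j)%N) u :
  u \in multi_subspace v m -> coord v (tagnat.Rank j (Ordinal hj)) u = 0.
Proof.
set t := tagnat.Rank _ _.
suff : (multi_subspace v m <= lker (linfun (coord v t : 'cV[C]_n -> C^o)))%VS.
  by move=> /subvP/(_ u)/[apply]; rewrite memv_ker lfunE => /eqP.
apply/subv_sumP => j' _; apply/subv_sumP => i lti.
rewrite -memvE memv_ker lfunE /=.
rewrite coord_block_vec -val_eqE tagnat.eq_Rank /=.
case: (j =P j') => [eq_j|_]; last by rewrite eqxx.
by rewrite gtn_eqF ?eqxx // eq_j.
Qed.

Hypotheses (opA : operator_algebra A) (hA : hereditarily_antisymmetric A).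

(** The span [E] of initial segments of the blocks is invariant, and modulo [E] the next vectors of
    two blocks have distinct weights. Their projections keep these weights, so
    [orthogonal_eigenvectors_eq] forbids orthogonality. *)
Lemma block_basis_nonorthogonal : suitably_nonorthogonal v.
Proof.
move=> m lem j j' hj hj' ltj.
set E := multi_subspace v m; set x := block_vec v _; set y := block_vec v _.
have defE := multi_subspaceE lem.
have iE : invariant A E.
  rewrite /E defE; apply: (big_ind (invariant A)).
  - exact: invariant0.
  - by move=> F G; apply: invariantD.
  by move=> i _; apply: invariant_take_block.
have wE i (hi : (m i < block_size i)%N) :
    weight_mod A E (block_vec v (Ordinal hi)) (weight i).
  rewrite block_vecE; apply: weight_modS (weight_block_triangular hi).
  by rewrite /E defE (sumv_sup i).
have notE i (hi : (m i < block_size i)%N) : block_vec v (Ordinal hi) \notin E.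
  apply/negP => /(coord_multi_subspace hi); rewrite coord_block_vec eqxx.
  by move=> /eqP; rewrite oner_eq0.
have neq_w : weight j <> weight j'.
  move=> /eqP; rewrite /weight nth_uniq ?undup_uniq // => /eqP eq_j.
  by rewrite eq_j ltnn in ltj.
set P := orthoproj (orthocomp E).
have Pin u : P u \in orthocomp E := memv_pi _ _ _.
have PE u : P u - u \in E.
  by rewrite -opprB rpredN orthoproj_orthocomp_sub.
have wP u mu : weight_mod A E u mu -> weight_mod A E (P u) mu.
  by move=> wu; rewrite -[P u](subrKC u); apply: weight_modD.
have [a Aa neq_a] := weight_mod_neq (wE j hj) (wE j' hj') neq_w.
apply: contraNneq neq_a => xy; apply/eqP.
pose E1 := (E + <[P x]> + <[P y]>)%VS.
apply: (@orthogonal_eigenvectors_eq _ _ A E1 E a (P x) (P y)) => //.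
- apply: (@invariant_weight _ _ _ _ _ (weight j')).
    by apply: (@invariant_weight _ _ _ _ _ (weight j)) => //; apply/wP/wE.
  by apply: (weight_modS (addvSl _ _)); apply/wP/wE.
- by rewrite orthoproj_orthocomp_eq0 notE.
- by rewrite orthoproj_orthocomp_eq0 notE.
(* [P y - y] lies in [E], to which [P x] is orthogonal, so [P y] may be replaced by [y]. *)
- rewrite -[P y](subrK y) dotcvC dotcvDl [dotcv (P y - y) _]dotcvC.
  rewrite (orthocompP _ _ (Pin x)) // rmorph0 add0r.
  by rewrite [dotcv y _]dotcvC xy !rmorph0.
- exact: weight_mod_in (wP _ _ (wE j hj)) Aa.
exact: weight_mod_in (wP _ _ (wE j' hj')) Aa.
Qed.

Lemma block_basis_jordanesque a : a \in A -> jordanesque (matrix_in_basis v a).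
Proof.
move=> Aa.
(* All entries except those strictly above the diagonal within a block: modulo the earlier vectors
   of block [j'], [a] acts on a vector of that block by its weight, and these earlier vectors have
   coordinate zero at the given row. *)
have entry j j' (i : 'I_(block_size j)) (i' : 'I_(block_size j')) :
    ~~ ((j == j') && (i < i')%N) ->
    submxblock (matrix_in_basis v a) j j' i i' =
    weight j' a * (tagnat.Rank j i == tagnat.Rank j' i')%:R.
  move=> nlt; rewrite !mxE -/(block_vec v i').
  set t := tagnat.Rank j i; set u := a *m _.
  rewrite -coord_block_vec -[RHS]/(weight j' a *: (coord v t _ : C^o)).
  rewrite -linearZ /=.
  apply/eqP; rewrite -subr_eq0 -raddfB; apply/eqP.
  apply: (@coord_eq0_span t (take i' (weight_block j'))); last first.
    by rewrite /u block_vecE (weight_mod_in (weight_block_triangular _)).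
  move=> x /(nthP 0)[i1]; rewrite size_takel ?(ltnW (ltn_ord i')) // => lti1 <-.
  rewrite nth_take //; have lti1' := ltn_trans lti1 (ltn_ord i').
  rewrite -(block_vecE (Ordinal lti1')) coord_block_vec.
  case: eqP => // /(congr1 val)/eqP; rewrite /= tagnat.eq_Rank.
  move=> /andP[eqj /eqP/= eqi].
  by rewrite eqj eqi lti1 in nlt.
split=> [j j' neqj|j].
  apply/matrixP => i i'; rewrite entry ?(negPf neqj) // mxE.
  rewrite -val_eqE tagnat.eq_Rank.
  by rewrite (negPf neqj) mulr0.
split=> [i i' ltii|].
  rewrite entry ?eqxx /= -?leqNgt 1?ltnW // -val_eqE tagnat.eq_Rank eqxx /=.
  by rewrite gtn_eqF // mulr0.
by exists (weight j a) => i; rewrite entry ?eqxx ?ltnn // mulr1.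
Qed.

End BlockBasis.

(** * Conclusion over the complex numbers *)

Local Open Scope complex_scope.

Theorem theorem5p9 (R : realType) (n : nat) (A : {vspace 'M[R[i]]_n}) :
  operator_algebra A -> hereditarily_antisymmetric A ->
  exists (k : nat) (p : 'I_k -> nat)
         (v : (\sum_(j < k) p j)%N.-tuple 'cV[R[i]]_n),
    [/\ block_ordered_basis v, normalized v, suitably_nonorthogonal v
      & forall a, a \in A -> jordanesque (matrix_in_basis v a)].
Proof.
move=> opA hA; have [l al lT] := exists_adapted_basis opA hA.
exists (size (weights l)), (@block_size _ _ l), (block_basis l); split.
- exact: block_basis_ordered al lT.
- exact: block_basis_normalized al.
- exact: block_basis_nonorthogonal al lT opA hA.
- exact: block_basis_jordanesque al lT.
Qed.
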